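(* Let $f\in C(J)$, $K\in C(J\times J)$, and assume that $K(\cdot,\varrho)\in C^{0,\nu}(J)$ with $0<\nu<1-\theta$. Then $$\frac{|(\mathcal{K}_R f)(t)-(\mathcal{K}_R f)(s)|}{|t-s|^\nu}\le c\|f\|_{\infty},\qquad \forall\, t,s\in J,\quad t\ne s.$$ Consequently, $$\|\mathcal{K}_R f\|_{0,\nu}\le c\|f\|_{\infty},\qquad 0<\nu<1-\theta.$$
   Context: $J=[0,1]$. The weakly singular adjoint Volterra integral operator $\mathcal{K}_R$ is defined by $(\mathcal{K}_R f)(t)=\int_t^1(\varrho-t)^{-\theta}K(t,\varrho)f(\varrho)\,d\varrho$ for $t\in J$, where $0<\theta<1$, $K\in C(J\times J)$ and $K(t,t)\ne 0$ for all $t\in J$. $\|\cdot\|_\infty$ is the supremum norm on $J$. For $\nu\in[0,1]$, $C^{0,\nu}(J)$ is the space of continuous functions on $J$ that are Hölder continuous of exponent $\nu$, with norm $\|f\|_{0,\nu}=\max_{t\in J}|f(t)|+\sup_{t,\varrho\in J,\,t\ne\varrho}\frac{|f(t)-f(\varrho)|}{|t-\varrho|^\nu}$. Here $c$ denotes a positive constant independent of $f$, $t$ and $s$.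
   Formalization: The hypothesis that K(·,ϱ) lies in C^{0,ν}(J) is taken with the norm of K(·,ϱ) bounded uniformly in ϱ; with membership only for each ϱ separately, no constant c need exist. *)

(* Defs.v *)
From HB Require Import structures.
From mathcomp Require Import all_boot all_order all_algebra.
From mathcomp Require Import all_classical all_reals all_analysis.
Set Implicit Arguments.
Unset Strict Implicit.
Unset Printing Implicit Defensive.
Import Order.TTheory GRing.Theory Num.Theory.
Import numFieldNormedType.Exports.

Local Open Scope classical_set_scope.
Local Open Scope ring_scope.

Section Defs.
Variable R : realType.

Definition J : set R := `[0, 1].

(* Functions on J are total functions on R; every notion below depends only
   on their values on J. *)
Definition contJ (f : R -> R) : Prop := {within J, continuous f}.

(* The norms take values in the extended reals, so that an unbounded set has
   supremum +oo (the supremum in R would be 0 by convention). *)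
Definition sup_normJ (f : R -> R) : \bar R :=
  ereal_sup [set y | exists2 t, J t & y = `|f t|%:E].

Definition holder_quotient (nu : R) (f : R -> R) (t s : R) : R :=
  `|f t - f s| / `|t - s| `^ nu.

Definition holder_seminorm (nu : R) (f : R -> R) : \bar R :=
  ereal_sup [set y | exists t s : R,
    [/\ J t, J s, t != s & y = (holder_quotient nu f t s)%:E]].

Definition holder_norm (nu : R) (f : R -> R) : \bar R :=
  (sup_normJ f + holder_seminorm nu f)%E.

Definition holder_space (nu : R) : set (R -> R) :=
  [set f | contJ f /\ (holder_seminorm nu f < +oo)%E].

(* K(., r) is in C^{0,nu}(J), with a norm bounded uniformly in r: for a merely
   continuous K the Hoelder constants of the functions K(., r) may be unbounded
   in r, and the Hoelder estimate for the integral operator may then fail. *)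
Definition holder_in_fst (nu : R) (K : R * R -> R) : Prop :=
  (forall r, J r -> holder_space nu (fun t => K (t, r))) /\
  exists M : R, forall r, J r ->
    (holder_norm nu (fun t => K (t, r)) <= M%:E)%E.

Definition adjoint_volterra (theta : R) (K : R * R -> R) (f : R -> R)
    (t : R) : R :=
  \int[@lebesgue_measure R]_(r in `[t, 1])
    ((r - t) `^ (- theta) * K (t, r) * f r).

End Defs.
Arguments J {R}.

(* Main.v *)
Require Import Defs.
From HB Require Import structures.
From mathcomp Require Import all_boot all_order all_algebra.
From mathcomp Require Import all_classical all_reals all_analysis.
From mathcomp Require Import measurable_realfun ring lra.
Import Order.TTheory GRing.Theory Num.Theory.
Import numFieldNormedType.Exports.
Local Open Scope classical_set_scope.
Local Open Scope ring_scope.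

(** Write [k_u(r) = (r - u)^(-theta)] and let [V] be the image of [f]. Since [theta < 1], the
    singularity of [k_u] at [u] is integrable, with explicit masses given by the antiderivative
    [(r - u)^(1 - theta) / (1 - theta)].

    For [s < t], passing from [V s] to [V t] makes three errors: the piece of the integral over the
    gap []s, t]], the change of kernel from [k_s] to [k_t], and the change of coefficient from
    [K (s, r)] to [K (t, r)]. The first two have weights of mass at most
    [(t - s)^(1 - theta) / (1 - theta)], which [t - s <= 1] and [nu <= 1 - theta] turn into a
    multiple of [(t - s)^nu]. The third gets [(t - s)^nu] from the Hoelder continuity of [K] in its
    first variable, against a kernel of bounded mass.

    [Rintegral_weighted_bound] bounds each error by a sup norm times the mass of a weight,
    [integral_power_kernel] computes the masses, and [power_kernel_integral_holder] adds the errors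
    up. The bound on the full norm then follows because [V 1 = 0]. *)

Lemma Rintegral_weighted_bound d (T : measurableType d) (R : realType)
    (mu : {measure set T -> \bar R}) (D : set T) (w h : T -> R) (C : R) :
  measurable D -> mu.-integrable D (EFin \o w) -> (forall x, D x -> 0 <= w x) ->
  measurable_fun D h -> (forall x, D x -> `|h x| <= C) ->
  mu.-integrable D (EFin \o (fun x => w x * h x)) /\
  `|\int[mu]_(x in D) (w x * h x)| <= C * \int[mu]_(x in D) w x.
Proof.
move=> mD iw w0 mh hC.
have mw : measurable_fun D w by apply/measurable_EFinP; case/integrableP: iw.
have mwh : measurable_fun D (fun x => w x * h x) by exact: measurable_funM.
have iCw : mu.-integrable D (EFin \o (fun x => C * w x)).
  by apply: eq_integrable (integrableZl mD C iw).
have bound x : D x -> `|w x * h x| <= C * w x.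
  by move=> Dx; rewrite normrM ger0_norm ?w0// mulrC ler_wpM2r ?w0// hC.
have iwh : mu.-integrable D (EFin \o (fun x => w x * h x)).
  apply: le_integrable iCw => //; first exact/measurable_EFinP.
  move=> x Dx /=; rewrite lee_fin (le_trans (bound x Dx))//; exact: ler_norm.
split=> //; apply: le_trans (le_normr_Rintegral mD iwh) _.
rewrite -RintegralZl//; apply: le_Rintegral => //.
exact: integrable_norm iwh.
Qed.

(** * Masses of the weakly singular kernel, and the three-term estimate *)

Section power_kernel.
Context {R : realType}.
Implicit Types (theta nu s t x y r : R).
Notation mu := (@lebesgue_measure R).

Lemma measurable_power_kernel theta s (D : set R) :
  measurable_fun D (fun r => (r - s) `^ (- theta)).
Proof.
apply: measurable_funS (measurableT) (@subsetT _ _) _.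
apply: (@measurableT_comp _ _ _ _ _ _ (@powR R ^~ (- theta))).
  exact: measurable_powR.
exact: measurable_funB.
Qed.

Let is_derive_shift_powR a s r : s < r ->
  is_derive r 1 (fun r => (r - s) `^ a) (a * (r - s) `^ (a - 1)).
Proof.
move=> sr; have rs : 0 < r - s by rewrite subr_gt0.
have shift1 : is_derive r 1 (fun r : R => r - s) 1.
  by apply: is_derive_eq; rewrite subr0.
have := @is_derive1_comp _ (@powR R ^~ a) (fun r => r - s) r _ _
  (is_derive1_powR a rs) shift1.
by rewrite mulr1.
Qed.

Let is_derive_power theta s r : theta < 1 -> s < r ->
  is_derive r 1 (fun r => (r - s) `^ (1 - theta) / (1 - theta))
    ((r - s) `^ (- theta)).
Proof.
move=> theta1 sr.
have -> : (fun r => (r - s) `^ (1 - theta) / (1 - theta)) =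
  (1 - theta)^-1 \*: (fun r => (r - s) `^ (1 - theta)).
  by apply/funext => u /=; rewrite mulrC.
have := @is_deriveZ _ _ _ _ (1 - theta)^-1 _ _ _
  (@is_derive_shift_powR (1 - theta) s r sr).
move=> /is_derive_eq; apply.
rewrite /GRing.scale/= mulKf ?gt_eqF ?subr_gt0//.
by congr (_ `^ _); ring.
Qed.

(** The integrand may blow up at [s], so the fundamental theorem of calculus is used on the compact
    intervals [[e n, y]], which increase to []s, y]]; monotone convergence passes to the limit, and
    the boundary term at [e n] vanishes because [1 - theta > 0]. *)
Lemma integral_power_kernel theta s y : theta < 1 -> s <= y ->
  (\int[mu]_(r in `]s, y]) ((r - s) `^ (- theta))%:E =
   ((y - s) `^ (1 - theta) / (1 - theta))%:E)%E.
Proof.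
move=> theta1; rewrite le_eqVlt => /predU1P[<-|sy].
  rewrite set_itv_ge ?bnd_simp ?ltxx// integral_set0 subrr powR0 ?mul0r//.
  by rewrite subr_eq0 gt_eqF.
pose G r := (r - s) `^ (1 - theta) / (1 - theta).
pose e n : R := s + n.+1%:R^-1.
have es n : s < e n by rewrite ltrDl invr_gt0.
have FTC n : e n < y -> (\int[mu]_(r in `[e n, y]) ((r - s) `^ (- theta))%:E =
    (G y - G (e n))%:E)%E.
  move=> eny; rewrite (continuous_FTC2 (F := G)) ?EFinB//.
  - apply: derivable_within_continuous => r; rewrite in_itv/= => /andP[er _].
    by have [] := @is_derive_shift_powR (- theta) s r (lt_le_trans (es n) er).
  - have dG r : s < r -> derivable G r 1 by move=> /(@is_derive_power theta _ _ theta1)[].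
    have cG r : s < r -> {for r, continuous G}.
      by move=> /dG /derivable1_diffP /differentiable_continuous.
    split.
    + by move=> r; rewrite in_itv/= => /andP[er _]; apply/dG/(lt_trans (es n)).
    + exact/cvg_at_right_filter/cG/es.
    + exact/cvg_at_left_filter/cG/(lt_trans (es n)).
  - move=> r; rewrite in_itv/= => /andP[er _].
    rewrite derive1E; have := @is_derive_power theta s r theta1.
    by move=> /(_ (lt_trans (es n) er))[_ ->].
have cvgG : ((G y - G (e n))%:E @[n --> \oo] --> (G y)%:E)%E.
  apply: cvg_EFin; first by near=> n.
  rewrite -[X in _ --> X]subr0; apply: cvgB; first exact: cvg_cst.
  rewrite -[X in _ --> X](mul0r (1 - theta)^-1); apply: cvgMl.
  have := @powR_cvg0 R (1 - theta); rewrite subr_gt0 => /(_ theta1).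
  move=> /cvg_at_rightP/(_ (fun n => e n - s)); apply; split.
    by move=> n; rewrite subr_gt0.
  by rewrite /e; under eq_fun do rewrite addrC addKr; exact: cvg_harmonic.
rewrite itv_open_bnd_bigcup -[\bigcup_i _]/(\bigcup_n `[e n, y]%classic).
have cvgI : (\int[mu]_(r in `[e n, y]) ((r - s) `^ (- theta))%:E
    @[n --> \oo] --> (G y)%:E)%E.
  (* [FTC] requires [e n < y], which holds only for large [n]. *)
  apply: cvg_trans cvgG; apply: near_eq_cvg; near=> n.
  rewrite FTC// -ltrBrDl; near: n.
  by apply: near_infty_natSinv_lt (PosNum _); rewrite subr_gt0.
apply: cvg_unique cvgI => //.
apply: ge0_nondecreasing_set_cvg_integral.
- move=> m n mn; rewrite subsetEset; apply: subset_itvr.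
  by rewrite bnd_simp lerD2l lef_pV2 ?posrE// ler_nat.
- by [].
- by move=> n; apply/measurable_EFinP; exact: measurable_power_kernel.
- by move=> n r _; rewrite lee_fin powR_ge0.
Unshelve. all: by end_near. Qed.

Lemma integrable_power_kernel theta s x y : theta < 1 -> s <= x ->
  mu.-integrable `]x, y] (EFin \o (fun r => (r - s) `^ (- theta))).
Proof.
move=> theta1 sx; have [yx|xy] := leP y x.
  by rewrite set_itv_ge ?bnd_simp -?leNgt//; exact: integrable_set0.
have isy : mu.-integrable `]s, y] (EFin \o (fun r => (r - s) `^ (- theta))).
  apply/integrableP; split.
    by apply/measurable_EFinP; exact: measurable_power_kernel.
  under eq_integral do rewrite /= ger0_norm ?powR_ge0//.
  by rewrite integral_power_kernel ?ltry// (le_trans sx)// ltW.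
by apply: integrableS isy => //; apply: subset_itvr; rewrite bnd_simp.
Qed.

Lemma Rintegral_power_kernel theta s x y : theta < 1 -> s <= x -> x <= y ->
  \int[mu]_(r in `]x, y]) (r - s) `^ (- theta) =
  ((y - s) `^ (1 - theta) - (x - s) `^ (1 - theta)) / (1 - theta).
Proof.
move=> theta1 sx xy.
rewrite -(@Rintegral_itvB R _ (BRight s) (BRight y) x) ?bnd_simp//; last first.
  exact: integrable_power_kernel.
by rewrite /Rintegral !integral_power_kernel ?(le_trans sx)// mulrBl.
Qed.

(* The difference of the two integrals is the integral of [k_s g] over the
   gap ]s, t] minus that of [(k_t - k_s) g] over ]t, 1] plus that of
   [k_t (g - h)] over ]t, 1], with [k_s r = (r - s)^(- theta)]; as [k] decreases,
   the total mass of each of the three weights is explicit. *)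
Lemma power_kernel_integral_holder theta nu s t (C : R) (g h : R -> R) :
  0 < theta -> theta < 1 -> 0 <= nu -> nu <= 1 - theta ->
  0 <= s -> s < t -> t <= 1 -> 0 <= C ->
  measurable_fun `]s, 1] g -> measurable_fun `]t, 1] h ->
  (forall r, s < r -> r <= 1 -> `|g r| <= C) ->
  (forall r, t < r -> r <= 1 -> `|g r - h r| <= C * (t - s) `^ nu) ->
  `|\int[mu]_(r in `]s, 1]) ((r - s) `^ (- theta) * g r) -
    \int[mu]_(r in `]t, 1]) ((r - t) `^ (- theta) * h r)|
  <= 3 * C / (1 - theta) * (t - s) `^ nu.
Proof.
move=> theta0 theta1 nu0 nua s0 st t1 C0 mg mh gC ghC.
have a0 : 0 < 1 - theta by rewrite subr_gt0.
have ts0 : 0 < t - s by rewrite subr_gt0.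
(* As [0 < t - s <= 1], a smaller exponent gives a larger power. *)
have PN : (t - s) `^ (1 - theta) <= (t - s) `^ nu.
  by apply: ger_powR => //; rewrite ts0/=; lra.
have UV : (1 - t) `^ (1 - theta) <= (1 - s) `^ (1 - theta).
  by rewrite ge0_ler_powR ?nnegrE; lra.
have U1 : (1 - t) `^ (1 - theta) <= 1.
  have := @ge0_ler_powR R (1 - theta) (ltW a0) (1 - t) 1.
  by rewrite powR1; apply; rewrite ?nnegrE; lra.
have N0 := powR_ge0 (t - s) nu.
have ai0 : 0 <= (1 - theta)^-1 by rewrite invr_ge0 ltW.
set a' := (1 - theta)^-1 in ai0 *.
set N := (t - s) `^ nu in PN N0 *.
set P := (t - s) `^ (1 - theta) in PN *.
set U := (1 - t) `^ (1 - theta) in UV U1 *.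
set V := (1 - s) `^ (1 - theta) in UV *.
have Ca0 : 0 <= C * a' by exact: mulr_ge0.
(* [E1], [E2], [E3] treat the gap, the change of kernel and the change of integrand; each costs at
   most [C * a' * N], whence the factor 3. In [E2] the mass is at most [P * a'] since [U <= V]; in
   [E3] it is at most [a'] since [U <= 1]. *)
have E1 : C * (P * a') <= C * a' * N by rewrite mulrCA mulrC ler_wpM2l.
have E2 : C * (U * a' - (V - P) * a') <= C * a' * N.
  rewrite (_ : C * _ = C * a' * (U - V + P)); last by ring.
  by rewrite ler_wpM2l//; lra.
have E3 : C * N * (U * a') <= C * a' * N.
  rewrite (_ : C * N * _ = C * a' * N * U); last by ring.
  by rewrite ler_piMr// mulr_ge0.
pose k u r : R := (r - u) `^ (- theta).
have ik u x y : u <= x -> mu.-integrable `]x, y] (EFin \o k u).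
  exact: integrable_power_kernel.
have st1 : `]t, 1] `<=` `]s, 1].
  by apply: subset_itvr; rewrite bnd_simp ltW.
have st2 : `]s, t] `<=` `]s, 1].
  by apply: subset_itvl; rewrite bnd_simp.
have mgt : measurable_fun `]t, 1] g by apply: measurable_funS mg.
have mgs : measurable_fun `]s, t] g by apply: measurable_funS mg.
have gbd r : `]s, 1]%classic r -> `|g r| <= C.
  by rewrite /= in_itv/= => /andP[]; exact: gC.
have [ikg _] := @Rintegral_weighted_bound _ _ _ mu `]s, 1]%classic (k s) g C
  (measurable_itv _) (ik s s 1 (lexx _)) (fun r _ => powR_ge0 _ _) mg gbd.
have [ikgs I1] := @Rintegral_weighted_bound _ _ _ mu `]s, t]%classic (k s) g C
  (measurable_itv _) (ik s s t (lexx _)) (fun r _ => powR_ge0 _ _) mgs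
  (fun r Dr => gbd r (st2 r Dr)).
have ikk : mu.-integrable `]t, 1] (EFin \o (fun r => k t r - k s r)).
  by apply: (integrableB _ (ik t t 1 (lexx _)) (ik s t 1 (ltW st))).
(* [r - t <= r - s] and the exponent [- theta] is negative, so [k t - k s] is itself a nonnegative
   weight: its mass is a plain difference of masses. *)
have kk0 r : `]t, 1]%classic r -> 0 <= k t r - k s r.
  rewrite /= in_itv/= => /andP[tr _]; rewrite subr_ge0 /k !powRN.
  rewrite lef_pV2 ?posrE ?powR_gt0 ?subr_gt0 ?(lt_trans st)//.
  rewrite ge0_ler_powR ?nnegrE ?subr_ge0 ?(ltW theta0)// ?(ltW tr)//.
    by rewrite (le_trans (ltW st))// ltW.
  by rewrite lerB// ltW.
have [ikkg I2] := @Rintegral_weighted_bound _ _ _ mu `]t, 1]%classic _ g C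
  (measurable_itv _) ikk kk0 mgt (fun r Dr => gbd r (st1 r Dr)).
have [ikgh I3] := @Rintegral_weighted_bound _ _ _ mu `]t, 1]%classic (k t)
  (fun r => g r - h r) (C * (t - s) `^ nu)
  (measurable_itv _) (ik t t 1 (lexx _)) (fun r _ => powR_ge0 _ _)
  (measurable_funB mgt mh)
  (fun r Dr => ltac:(move: Dr; rewrite /= in_itv/= => /andP[]; exact: ghC)).
have [ikgt _] := @Rintegral_weighted_bound _ _ _ mu `]t, 1]%classic (k t) g C
  (measurable_itv _) (ik t t 1 (lexx _)) (fun r _ => powR_ge0 _ _) mgt
  (fun r Dr => gbd r (st1 r Dr)).
have split_s : \int[mu]_(r in `]s, 1]) (k s r * g r) =
    \int[mu]_(r in `]s, t]) (k s r * g r) +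
    \int[mu]_(r in `]t, 1]) (k s r * g r).
  rewrite -(@Rintegral_itvB R _ (BRight s) (BRight 1) t) ?bnd_simp//; last exact: ltW.
  by rewrite addrC subrK.
have ksg : \int[mu]_(r in `]t, 1]) (k s r * g r) =
    \int[mu]_(r in `]t, 1]) (k t r * g r) -
    \int[mu]_(r in `]t, 1]) ((k t r - k s r) * g r).
  by rewrite -RintegralB//; apply: eq_Rintegral => r _; ring.
have kth : \int[mu]_(r in `]t, 1]) (k t r * h r) =
    \int[mu]_(r in `]t, 1]) (k t r * g r) -
    \int[mu]_(r in `]t, 1]) (k t r * (g r - h r)).
  by rewrite -RintegralB//; apply: eq_Rintegral => r _; ring.
rewrite -/(k s) -/(k t) in I1 I2 I3 *.
rewrite [X in `|X - _|]split_s ksg [X in `|_ - X|]kth.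
set A1 := \int[mu]_(r in `]s, t]) (k s r * g r) in I1 *.
set A2 := \int[mu]_(r in `]t, 1]) ((k t r - k s r) * g r) in I2 *.
set A3 := \int[mu]_(r in `]t, 1]) (k t r * (g r - h r)) in I3 *.
set B := \int[mu]_(r in `]t, 1]) (k t r * g r).
(* The common term [B], which is not small, cancels. *)
have -> : A1 + (B - A2) - (B - A3) = A1 - A2 + A3 by ring.
apply: le_trans (ler_normD _ _) _; apply: le_trans (lerD (ler_normB _ _) (lexx _)) _.
rewrite Rintegral_power_kernel ?(ltW st)// in I1.
rewrite RintegralB ?ik ?(ltW st)// !Rintegral_power_kernel ?(ltW st)// in I2.
rewrite Rintegral_power_kernel// in I3.
have pa0 : 0 `^ (1 - theta) = 0 :> R by rewrite powR0// gt_eqF.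
rewrite !subrr pa0 !subr0 -/P -/N -/U -/V -/a' in I1 I2 I3.
rewrite (_ : 3 * C * a' * N = C * a' * N + C * a' * N + C * a' * N); last by ring.
by rewrite !lerD// ?(le_trans I1)// ?(le_trans I2)// (le_trans I3).
Qed.

End power_kernel.

(** * Sup norm, Hoelder seminorm and continuity on [J] *)

Section holder_functions.
Context {R : realType}.
Implicit Types (nu C M t s : R) (f : R -> R).

Let J0 : @J R 0. Proof. by rewrite /J /= in_itv/= lexx ler01. Qed.
Let J1 : @J R 1. Proof. by rewrite /J /= in_itv/= lexx ler01. Qed.

Lemma sup_normJ_ubound f t : J t -> (`|f t|%:E <= sup_normJ f)%E.
Proof. by move=> Jt; apply: ereal_sup_ubound; exists t. Qed.

Lemma sup_normJ_ge0 f : (0 <= sup_normJ f)%E.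
Proof. by apply: le_trans (sup_normJ_ubound f 0 J0); rewrite lee_fin. Qed.

Lemma holder_seminorm_ubound nu f t s : J t -> J s -> t != s ->
  ((holder_quotient nu f t s)%:E <= holder_seminorm nu f)%E.
Proof. by move=> Jt Js ts; apply: ereal_sup_ubound; exists t, s. Qed.

Lemma holder_seminorm_ge0 nu f : (0 <= holder_seminorm nu f)%E.
Proof.
(* One admissible pair is enough; it also rules out the value [-oo] of an empty supremum. *)
apply: le_trans (@holder_seminorm_ubound nu f 1 0 J1 J0 (oner_neq0 _)).
by rewrite lee_fin divr_ge0// powR_ge0.
Qed.

Lemma holder_quotient_le nu f C t s : t != s ->
  (holder_quotient nu f t s <= C) = (`|f t - f s| <= C * `|t - s| `^ nu).
Proof.
by move=> ts; rewrite ler_pdivrMr// powR_gt0// normr_gt0 subr_eq0.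
Qed.

Lemma sup_normJ_fin_num f : contJ f -> sup_normJ f \is a fin_num.
Proof.
move=> cf; rewrite ge0_fin_numE ?sup_normJ_ge0//.
have cnf : {within J, continuous (fun x => `|f x|)}.
  by move=> x; apply: cvg_norm; exact: cf.
have [c _ fc] := @EVT_max R _ 0 1 ler01 cnf.
apply: le_lt_trans (ltry `|f c|); apply: ge_ereal_sup => _ [t Jt ->].
by rewrite lee_fin fc.
Qed.

Lemma contJ_holder nu C f : 0 < nu -> 0 <= C ->
  (forall t s, J t -> J s -> `|f t - f s| <= C * `|t - s| `^ nu) -> contJ f.
Proof.
move=> nu0 C0 fC; apply/subspace_continuousP => x Jx.
apply/cvgrPdist_le => e e0.
(* The radius will be [(e / (C + 1))^(1 / nu)]; adding 1 avoids division by zero when [C = 0]. *)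
have d0 : 0 < e / (C + 1) by rewrite divr_gt0// ltr_wpDl.
rewrite near_withinE.
near=> y => Jy; apply: le_trans (fC _ _ Jx Jy) _.
apply: (@le_trans _ _ (C * (e / (C + 1)))).
  rewrite ler_wpM2l//.
  have -> : e / (C + 1) = ((e / (C + 1)) `^ nu^-1) `^ nu.
    by rewrite -powRrM mulVf ?gt_eqF// powRr1// ltW.
  rewrite ge0_ler_powR ?nnegrE ?powR_ge0// ?(ltW nu0)//.
  apply/ltW; near: y; apply: (@nbhsx_ballx R R x ((e / (C + 1)) `^ nu^-1)).
  exact: powR_gt0.
rewrite mulrCA ler_piMr ?(ltW e0)// ler_pdivrMr ?ltr_wpDl// mul1r.
by rewrite lerDl.
Unshelve. all: by end_near. Qed.

(** Both summands of the Hoelder norm are nonnegative, so the uniform bound on the norm bounds each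
    of them separately. *)
Lemma holder_in_fst_bound nu (K : R * R -> R) : holder_in_fst nu K ->
  exists2 M : R, 0 <= M & forall t s r, J t -> J s -> J r ->
    `|K (t, r)| <= M /\ `|K (t, r) - K (s, r)| <= M * `|t - s| `^ nu.
Proof.
move=> [_ [M KM]].
have KbM t r : J t -> J r -> `|K (t, r)| <= M.
  move=> Jt Jr; rewrite -lee_fin; apply: le_trans (KM _ Jr).
  rewrite -[leLHS]adde0; apply: leeD (holder_seminorm_ge0 _ _).
  exact: (sup_normJ_ubound (fun t => K (t, r)) t).
exists M => [|t s r Jt Js Jr]; first exact: le_trans (KbM 0 0 J0 J0).
split; first exact: KbM.
have [->|ts] := eqVneq t s.
  by rewrite subrr normr0 mulr_ge0 ?powR_ge0// (le_trans _ (KbM 0 0 J0 J0)).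
rewrite -(@holder_quotient_le nu (fun t => K (t, r)))// -lee_fin.
apply: le_trans (KM _ Jr); rewrite -[leLHS]add0e.
apply: leeD; first exact: sup_normJ_ge0.
exact: (holder_seminorm_ubound nu (fun t => K (t, r))).
Qed.

Lemma measurable_contJ f : contJ f -> measurable_fun J f.
Proof. by apply: subspace_continuous_measurable_fun; exact: measurable_itv. Qed.

Lemma contJ_section (K : R * R -> R) t : {within J `*` J, continuous K} ->
  J t -> contJ (fun r => K (t, r)).
Proof.
move=> /subspace_continuousP cK Jt; apply/subspace_continuousP => x Jx.
(* [K] is continuous only relative to the square, so [r] has to approach [x] inside [J]. *)
suff pairJ : (t, r) @[r --> within J (nbhs x)] --> within (J `*` J) (nbhs (t, x)).
  exact: (cvg_comp _ _ pairJ (cK (t, x) (conj Jt Jx))).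
move=> W; rewrite /= /within/= => nW.
have pairx : (t, r) @[r --> x] --> (t, x).
  by apply: (@cvg_pair _ _ _ _ (nbhs t) (nbhs x)); [exact: cvg_cst|exact: cvg_id].
have := pairx _ nW; rewrite !nbhs_filterE /= => WJ.
by near=> r => Jr; apply: (near WJ r).
Unshelve. all: by end_near. Qed.

End holder_functions.

(** * The operator: Hoelder estimate and norm bound *)

(** For [s < t] this is [power_kernel_integral_holder] with [g = K (s, _) * f], [h = K (t, _) * f]
    and [C = M * F]; the remaining cases follow by symmetry. *)
Lemma adjoint_volterra_holder (R : realType) (theta nu M F : R)
    (K : R * R -> R) (f : R -> R) :
  0 < theta -> 0 <= nu -> nu <= 1 - theta -> theta < 1 -> 0 <= M -> 0 <= F ->
  {within J `*` J, continuous K} ->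
  (forall t s r, J t -> J s -> J r ->
    `|K (t, r)| <= M /\ `|K (t, r) - K (s, r)| <= M * `|t - s| `^ nu) ->
  contJ f -> (forall t, J t -> `|f t| <= F) ->
  forall t s, J t -> J s ->
  `|adjoint_volterra theta K f t - adjoint_volterra theta K f s| <=
    3 * (M * F) / (1 - theta) * `|t - s| `^ nu.
Proof.
move=> theta0 nu0 nua theta1 M0 F0 cK KM cf fF.
have MF0 : 0 <= M * F by exact: mulr_ge0.
have sub01 (u : R) : J u -> `]u, 1] `<=` J.
  by rewrite /J /= in_itv/= => /andP[u0 _]; apply: subset_itv; rewrite ?bnd_simp.
have mKf u : J u -> measurable_fun `]u, 1] (fun r => K (u, r) * f r).
  move=> Ju; have mJ : measurable_fun J (fun r => K (u, r) * f r).
    by apply: measurable_funM; apply: measurable_contJ => //; exact: contJ_section.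
  by apply: measurable_funS mJ; [exact: measurable_itv|exact: sub01].
have KfMF u r : J u -> J r -> `|K (u, r) * f r| <= M * F.
  by move=> Ju Jr; rewrite normrM ler_pM ?fF//; exact: (KM u u r Ju Ju Jr).1.
(* Dropping the null endpoint [u] brings the operator to the half-open intervals on which the masses
   are computed. *)
have openV u : J u -> adjoint_volterra theta K f u =
    \int[lebesgue_measure]_(r in `]u, 1]) ((r - u) `^ (- theta) * (K (u, r) * f r)).
  move=> Ju; rewrite /adjoint_volterra; under eq_Rintegral do rewrite -mulrA.
  rewrite -Rintegral_itv_obnd_cbnd//.
  have [//] := @Rintegral_weighted_bound _ _ _ (@lebesgue_measure R) `]u, 1]%classic
    (fun r => (r - u) `^ (- theta)) (fun r => K (u, r) * f r) (M * F)
    (measurable_itv _) (integrable_power_kernel theta u u 1 theta1 (lexx u))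
    (fun r _ => powR_ge0 _ _) (mKf u Ju)
    (fun r Dr => KfMF u r Ju (sub01 u Ju r Dr)).
have main t s : J t -> J s -> s < t ->
  `|adjoint_volterra theta K f s - adjoint_volterra theta K f t| <=
    3 * (M * F) / (1 - theta) * `|t - s| `^ nu.
  move=> Jt Js st; rewrite !openV// [`|t - s|]ger0_norm ?subr_ge0 ?(ltW st)//.
  have /andP[s0 s1] : 0 <= s <= 1 by move: Js; rewrite /J/= in_itv.
  have /andP[t0 t1] : 0 <= t <= 1 by move: Jt; rewrite /J/= in_itv.
  have JR r : s < r -> r <= 1 -> J r.
    by move=> sr r1; rewrite /J/= in_itv/= r1 andbT (le_trans s0)// ltW.
  apply: power_kernel_integral_holder => //; [exact: mKf|exact: mKf| |].
    by move=> r sr r1; apply: KfMF => //; exact: JR.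
  move=> r tr r1; have Jr := JR r (lt_trans st tr) r1.
  rewrite -mulrBl normrM mulrAC ler_pM ?fF//.
  rewrite distrC -[t - s]ger0_norm ?subr_ge0 ?(ltW st)//.
  exact: (KM t s r Jt Js Jr).2.
move=> t s Jt Js; have [st|ts|->] := ltgtP s t.
- by rewrite distrC; exact: main.
- by rewrite (distrC t s); exact: main.
- rewrite subrr normr0 mulr_ge0 ?powR_ge0// divr_ge0 ?mulr_ge0//.
  by rewrite subr_ge0 ltW.
Qed.

Theorem lemma4p6 (R : realType) (theta nu : R) (K : R * R -> R)
    (theta_gt0 : 0 < theta) (theta_lt1 : theta < 1)
    (nu_gt0 : 0 < nu) (nu_lt : nu < 1 - theta)
    (K_cont : {within J `*` J, continuous K})
    (K_diag : forall t : R, J t -> K (t, t) != 0)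
    (K_holder : holder_in_fst nu K) :
  exists c : R, 0 < c /\
    forall f : R -> R, contJ f ->
      (forall t s : R, J t -> J s -> t != s ->
         ((holder_quotient nu (adjoint_volterra theta K f) t s)%:E
            <= c%:E * sup_normJ f)%E) /\
      holder_space nu (adjoint_volterra theta K f) /\
      (holder_norm nu (adjoint_volterra theta K f)
         <= c%:E * sup_normJ f)%E.
Proof.
have [M M0 KM] := holder_in_fst_bound _ _ K_holder.
have a0 : 0 < 1 - theta by rewrite subr_gt0.
pose c1 : R := 3 * M / (1 - theta).
have c10 : 0 <= c1 by rewrite divr_ge0 ?mulr_ge0// ltW.
(* One [c1] pays for the sup norm and one for the seminorm; the extra 1 makes the constant positive,
   as [c1] is only known to be nonnegative. *)
exists (2 * c1 + 1); split; first by rewrite ltr_wpDl// mulr_ge0.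
move=> f cf.
(* Continuity on the compact [J] makes the sup norm a real number [F], so the estimates become real
   inequalities. *)
have fin := sup_normJ_fin_num _ cf; rewrite -(fineK fin).
set F := fine (sup_normJ f).
have F0 : 0 <= F by rewrite fine_ge0// sup_normJ_ge0.
have fF t : J t -> `|f t| <= F.
  by move=> Jt; rewrite -lee_fin fineK//; exact: sup_normJ_ubound.
set V := adjoint_volterra theta K f.
have VH t s : J t -> J s -> `|V t - V s| <= c1 * F * `|t - s| `^ nu.
  move=> Jt Js; rewrite (_ : c1 * F = 3 * (M * F) / (1 - theta)); last first.
    by rewrite /c1; ring.
  exact: (adjoint_volterra_holder _ _ _ _ _ _ _ _ (ltW nu_gt0) (ltW nu_lt)).
have c1F0 : 0 <= c1 * F by exact: mulr_ge0.
have VQ t s : J t -> J s -> t != s -> holder_quotient nu V t s <= c1 * F.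
  by move=> Jt Js ts; rewrite holder_quotient_le//; exact: VH.
have semiV : (holder_seminorm nu V <= (c1 * F)%:E)%E.
  by apply: ge_ereal_sup => _ [t [s [Jt Js ts ->]]]; rewrite lee_fin VQ.
(* As V vanishes at 1, its sup norm is controlled by its Hoelder seminorm. *)
have V1 : V 1 = 0 by rewrite /V /adjoint_volterra set_itv1 Rintegral_set1.
have supV : (sup_normJ V <= (c1 * F)%:E)%E.
  apply: ge_ereal_sup => _ [t Jt ->]; rewrite lee_fin -[V t]subr0 -V1.
  have J1 : J (1 : R) by rewrite /J/= in_itv/= ler01 lexx.
  apply: le_trans (VH _ _ Jt J1) _; rewrite ler_piMr//.
  have /andP[t0 t1] : 0 <= t <= 1 by move: Jt; rewrite /J/= in_itv.
  have := @ge0_ler_powR R nu (ltW nu_gt0) `|t - 1| 1; rewrite powR1.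
  by apply; rewrite ?nnegrE// distrC ger0_norm ?subr_ge0// gerBl.
split=> [t s Jt Js ts|].
  rewrite -EFinM lee_fin (le_trans (VQ _ _ Jt Js ts))// ler_wpM2r//.
  by rewrite mulr_natl mulr2n -addrA lerDl addr_ge0.
split; first split.
- exact: contJ_holder nu_gt0 c1F0 VH.
- exact: le_lt_trans semiV (ltry _).
apply: (le_trans (leeD supV semiV)).
by rewrite -EFinD -EFinM lee_fin mulrDl mul1r mulr_natl mulr2n mulrDl -[leLHS]addr0 lerD.
Qed.
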